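(* Let $\mathcal{F}=\{f_{n}\}_{n\in\mathbb{N}}$ be a time varying map on a metric space $(X,d)$ and let $Y$ be a subset of $X$. If $Y\subseteq f_{n}(Y)$ for every $n\in\mathbb{N}$ and $\mathcal{F}$ has the s-limit shadowing property on $Y$, then $\mathcal{F}$ also has the limit shadowing property on $Y$. In particular, if all the maps $f_n$ are surjective and $\mathcal{F}$ has the s-limit shadowing property, then $\mathcal{F}$ also has the limit shadowing property.
   Context: $\mathbb{N}=\{1,2,3,\dots\}$. A time varying map on a metric space $(X,d)$ is a sequence $\mathcal{F}=\{f_n\}_{n\in\mathbb{N}}$ of continuous maps $f_n:X\to X$. Put $\mathcal{F}_n:=f_n\circ f_{n-1}\circ\cdots\circ f_1$ for $n\ge 1$ and $\mathcal{F}_0:=\mathrm{Id}_X$. For $\delta>0$, a sequence $\{x_n\}_{n\ge 0}$ in $X$ is a $\delta$-pseudo orbit of $\mathcal{F}$ if $d(f_{n+1}(x_n),x_{n+1})<\delta$ for all $n\ge 0$. It is a limit pseudo orbit if $d(f_{n+1}(x_n),x_{n+1})\to 0$ as $n\to+\infty$. Limit shadowing property on $Y\subseteq X$: for every limit pseudo orbit $\{x_n\}_{n\ge0}$ contained in $Y$ there is $x\in X$ with $d(\mathcal{F}_n(x),x_n)\to 0$ as $n\to+\infty$. s-limit shadowing property on $Y\subseteq X$: for every $\varepsilon>0$ there is $\delta>0$ such that (1) for every $\delta$-pseudo orbit $\{x_n\}_{n\ge0}$ contained in $Y$ there exists $x\in X$ with $d(\mathcal{F}_n(x),x_n)<\varepsilon$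 for all $n\ge 0$, and (2) if in addition $\{x_n\}_{n\ge0}$ is a limit pseudo orbit, then (this $x$ can be taken so that) $d(\mathcal{F}_n(x),x_n)\to0$ as $n\to+\infty$. When $Y=X$ the words ''on $Y$'' are omitted. *)

(* Defs.v *)
From mathcomp Require Import all_boot all_order all_algebra.
From mathcomp Require Import all_classical all_reals all_analysis.
Set Implicit Arguments.
Unset Strict Implicit.
Unset Printing Implicit Defensive.
Import Order.TTheory GRing.Theory Num.Theory.
Import numFieldNormedType.Exports.
Local Open Scope classical_set_scope.
Local Open Scope ring_scope.

(* The family f_1, f_2, ... is represented by f : nat -> X -> X with an index
   shift: [f n] is the map f_{n+1}.  Thus d(f_{n+1}(x_n), x_{n+1}) is
   [mdist (f n (x n)) (x n.+1)].  Orbits and pseudo orbits are indexed from 0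
   and are not shifted. *)

Definition time_varying_map (R : realType) (X : metricType R)
    (f : nat -> X -> X) : Prop :=
  forall n, continuous (f n).

(* [orbit_map f n] is f_n o ... o f_1. *)
Fixpoint orbit_map (X : Type) (f : nat -> X -> X) (n : nat) : X -> X :=
  if n is m.+1 then f m \o orbit_map f m else id.

Definition pseudo_orbit (R : realType) (X : metricType R)
    (f : nat -> X -> X) (delta : R) (x : nat -> X) : Prop :=
  forall n, mdist (f n (x n)) (x n.+1) < delta.

Definition limit_pseudo_orbit (R : realType) (X : metricType R)
    (f : nat -> X -> X) (x : nat -> X) : Prop :=
  mdist (f n (x n)) (x n.+1) @[n --> \oo] --> (0 : R).

Definition shadows (R : realType) (X : metricType R)
    (f : nat -> X -> X) (eps : R) (z : X) (x : nat -> X) : Prop :=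
  forall n, mdist (orbit_map f n z) (x n) < eps.

Definition limit_shadows (R : realType) (X : metricType R)
    (f : nat -> X -> X) (z : X) (x : nat -> X) : Prop :=
  mdist (orbit_map f n z) (x n) @[n --> \oo] --> (0 : R).

Definition limit_shadowing_on (R : realType) (X : metricType R)
    (f : nat -> X -> X) (Y : set X) : Prop :=
  forall x : nat -> X, (forall n, Y (x n)) ->
    limit_pseudo_orbit f x -> exists z : X, limit_shadows f z x.

(* In the second clause a single point z both eps-shadows and limit-shadows. *)
Definition s_limit_shadowing_on (R : realType) (X : metricType R)
    (f : nat -> X -> X) (Y : set X) : Prop :=
  forall eps : R, 0 < eps -> exists2 delta : R, 0 < delta &
    forall x : nat -> X, (forall n, Y (x n)) -> pseudo_orbit f delta x ->
      (exists z : X, shadows f eps z x) /\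
      (limit_pseudo_orbit f x ->
        exists z : X, shadows f eps z x /\ limit_shadows f z x).

Definition limit_shadowing (R : realType) (X : metricType R)
    (f : nat -> X -> X) : Prop :=
  limit_shadowing_on f [set: X].

Definition s_limit_shadowing (R : realType) (X : metricType R)
    (f : nat -> X -> X) : Prop :=
  s_limit_shadowing_on f [set: X].

(* Main.v *)
(** A limit pseudo orbit is a [delta]-pseudo orbit from some time [N] on, where
    [delta] is the constant given by s-limit shadowing for [eps = 1].  Since [Y]
    is contained in each [f n @` Y], the point [x N] can be pulled back inside
    [Y] along [f], so the first [N] terms can be replaced by an exact orbit
    segment ending at [x N].  The new sequence is a [delta]-pseudo orbit in [Y],
    and a point that limit-shadows it also limit-shadows [x]. *)
Require Import Defs.
From mathcomp Require Import all_boot all_order all_algebra.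
From mathcomp Require Import all_classical all_reals all_analysis.
Set Implicit Arguments.
Unset Strict Implicit.
Unset Printing Implicit Defensive.
Import Order.TTheory GRing.Theory Num.Theory.
Local Open Scope classical_set_scope.
Local Open Scope ring_scope.

(** Backward induction along the orbit, for all [x] at once: each step picks one more preimage
    inside [Y]. *)
Lemma exact_start (X : Type) (f : nat -> X -> X) (Y : set X) (N : nat)
    (x : nat -> X) :
  (forall n, Y `<=` f n @` Y) -> (forall n, Y (x n)) ->
  exists y : nat -> X, [/\ forall n, Y (y n),
    forall n, (N <= n)%N -> y n = x n &
    forall n, (n < N)%N -> f n (y n) = y n.+1].
Proof.
move=> Yf; elim: N x => [|N IHN] x Yx; first by exists x.
have [w Yw fw] := Yf N _ (Yx N.+1).
(* Putting the preimage [w] of [x N.+1] at index [N] makes the induction hypothesis build an exact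
   segment ending at [w]. *)
have [|y [Yy yE fy]] := IHN (fun n => if n == N then w else x n).
  by move=> n; case: ifP.
have yx n : (N < n)%N -> y n = x n.
  by move=> Nn; rewrite yE ?(ltnW Nn)// gtn_eqF.
exists y; split=> // n; rewrite ltnS leq_eqVlt => /predU1P[->|/fy//].
by rewrite yE// eqxx fw yx.
Qed.

Lemma s_limit_shadowing_on_limit (R : realType) (X : metricType R)
    (f : nat -> X -> X) (Y : set X) :
  (forall n, Y `<=` f n @` Y) ->
  s_limit_shadowing_on f Y -> limit_shadowing_on f Y.
Proof.
move=> Yf sf x Yx xlim.
have [delta delta0 shadow] := sf 1 ltr01.
have [N _ xdelta] : \forall n \near \oo, mdist (f n (x n)) (x n.+1) < delta.
  exact: (cvgr_lt 0 xlim).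
have [y [Yy yx fy]] := exact_start N Yf Yx.
have ypo : pseudo_orbit f delta y.
  (* The junction [n.+1 = N] falls in the exact case, so it adds no error. *)
  move=> n; have [Nn|nN] := leqP N n.
    by rewrite !yx ?(leqW Nn)//; exact: xdelta.
  by rewrite fy// mdistxx.
have ylim : limit_pseudo_orbit f y.
  apply: cvg_trans xlim; apply: near_eq_cvg.
  by exists N => // n /= Nn; rewrite !yx ?(leqW Nn).
have [_ /(_ ylim)[z [_ zy]]] := shadow y Yy ypo.
exists z; apply: cvg_trans zy; apply: near_eq_cvg.
by exists N => // n /= Nn; rewrite yx.
Qed.

Theorem lemma4p1 (R : realType) (X : metricType R) (f : nat -> X -> X)
    (hf : time_varying_map f) :
  (forall Y : set X, (forall n, Y `<=` f n @` Y) ->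
     s_limit_shadowing_on f Y -> limit_shadowing_on f Y) /\
  ((forall n, set_surj [set: X] [set: X] (f n)) ->
     s_limit_shadowing f -> limit_shadowing f).
Proof.
(* Surjectivity unfolds to the inclusion hypothesis with [Y] the whole space. *)
by split=> [Y|]; exact: s_limit_shadowing_on_limit.
Qed.
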